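(* Let $n$ be a positive integer. There exist a dihedral group $\Gamma$ of order $n^2$ and a $\Gamma$-semi-magic square $SMS_{\Gamma}(n)$ of side $n$ if and only if $n$ is even and $n\geq 4$.
   Context: The dihedral group $D_k$ ($k\ge 3$) is the group of order $2k$ with elements $r^0=e,r,r^2,\dots,r^{k-1}$ (rotations) and $s, rs,\dots,r^{k-1}s$ (reflections), where $r^k=e$, $(r^is)^2=e$ and $r^is=sr^{-i}$. A dihedral group of order $n^2$ is $D_{n^2/2}$ (so $n$ must be even for such a group to exist). Let $\Gamma$ be a group of order $n^2$. A $\Gamma$-semi-magic square of side $n$, denoted $SMS_\Gamma(n)$, is an $n\times n$ array $(a_{i,j})$ whose entries are all the elements of $\Gamma$, each appearing exactly once, such that there is an element $\mu\in\Gamma$ (the magic constant) with the following property: for every row $i$ there is an ordering $j_1,\dots,j_n$ of the column indices (possibly depending on $i$) with $a_{i,j_1}a_{i,j_2}\cdots a_{i,j_n}=\mu$, and for every column $j$ there is an ordering $i_1,\dots,i_n$ of the row indices (possibly depending on $j$) with $a_{i_1,j}a_{i_2,j}\cdots a_{i_n,j}=\mu$. *)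

(* Defs.v *)
From HB Require Import structures.
From mathcomp Require Import all_boot all_fingroup all_algebra all_solvable.

Set Implicit Arguments.
Unset Strict Implicit.
Unset Printing Implicit Defensive.

Local Open Scope group_scope.

(* In the library 'D_m is indexed by its order m, so the dihedral group D_k of
   order 2k is 'D_(k.*2); it is presented by x ^+ k, y ^+ 2, x ^ y = x^-1
   (lemma Grp_dihedral).  The Klein group 'D_4 (k = 2) is excluded. *)
Definition dihedral (gT : finGroupType) (G : {group gT}) : Prop :=
  exists2 k : nat, 3 <= k & G \isog 'D_(k.*2).

(* The orderings of the indices are permutations of 'I_n; the group product
   \prod_(k < n) is taken in increasing order of k. *)
Definition semi_magic_square (gT : finGroupType) (n : nat) (a : 'M[gT]_n) :
    Prop :=
  bijective (fun p : 'I_n * 'I_n => a p.1 p.2) /\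
  exists mu : gT,
    (forall i : 'I_n, exists s : 'S_n, \prod_(k < n) a i (s k) = mu) /\
    (forall j : 'I_n, exists s : 'S_n, \prod_(k < n) a (s k) j = mu).

(* Main.v *)
(* All lines are given product 1.  With x a rotation and y a reflection, a word
   in the elements x^k and x^k y has a product of the form x^S y^e, where S is
   an alternating sum of the exponents: the sign changes after every
   reflection.  If a word has product 1 with as many plus signs as minus signs,
   then this remains so when all exponents are shifted by the same amount.
   Hence a single p x q array filled with the x^k and x^k y, 0 <= k < pq/2,
   yields arrays filled with any window c <= k < c + pq/2, and such arrays can
   be juxtaposed.  Arrays of sizes 4 x 4, 4 x 6 and 6 x 6 suffice to reach all
   n x n with n >= 4 even. *)
Require Import Defs.
From mathcomp Require Import all_boot all_fingroup all_algebra all_solvable.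

Set Implicit Arguments.
Unset Strict Implicit.
Unset Printing Implicit Defensive.

(** * Words in rotations and reflections, and the three basic tables *)

(* The pair (b, k) stands for x ^+ k * y ^+ b. *)
Definition code := (bool * nat)%type.

Notation "''R' k" := ((false, k) : code) (at level 8, k at level 2).
Notation "''F' k" := ((true, k) : code) (at level 8, k at level 2).

(* The exponents counted positively, those counted negatively, and the parity
   of the number of reflections. *)
Fixpoint signed_exponents (w : seq code) : seq nat * seq nat * bool :=
  if w is (b, k) :: w' then
    let: (P, M, e) := signed_exponents w' in
    if b then (k :: M, P, ~~ e) else (k :: P, M, e)
  else ([::], [::], false).

Definition balanced (w : seq code) : bool :=
  let: (P, M, e) := signed_exponents w in
  [&& size P == size M, sumn P == sumn M & ~~ e].

Definition balanceable (l : seq code) : bool := has balanced (permutations l).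

Definition table_entry (t : seq (seq code)) (i j : nat) : code :=
  nth 'R 0 (nth [::] t i) j.

(** It is enough that every code occurs: when [p * q = m.*2], counting rules out repetitions. *)
Definition balanced_table (t : seq (seq code)) (p q m : nat) : bool :=
  [&& all (fun i => balanceable (mkseq (table_entry t i) q)) (iota 0 p),
      all (fun j => balanceable (mkseq (table_entry t ^~ j) p)) (iota 0 q)
    & all (fun k => all (fun b => (b, k) \in
             [seq table_entry t i j | i <- iota 0 p, j <- iota 0 q])
           [:: false; true]) (iota 0 m)].

(** In every row and column the two rotations and the two reflections have exponents with the same
    difference [d]. The word ['R a], ['F (c + d)], ['R (a + d)], ['F c] is then balanced. *)
Definition table4x4 : seq (seq code) :=
  [:: [:: 'R 0; 'R 1; 'F 0; 'F 1]; [:: 'R 2; 'R 3; 'F 2; 'F 3];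
      [:: 'F 4; 'F 5; 'R 4; 'R 5]; [:: 'F 6; 'F 7; 'R 6; 'R 7]].

(** Rows follow the pattern of [table4x4]. Columns rest on 0 + 10 + 4 = 1 + 8 + 5 and 2 + 11 + 6 = 3
    + 9 + 7, each used twice with rotations and reflections exchanged. *)
Definition table6x4 : seq (seq code) :=
  [:: [:: 'R 0; 'R 2; 'F 0; 'F 2];   [:: 'R 1; 'R 3; 'F 1; 'F 3];
      [:: 'F 4; 'F 6; 'R 4; 'R 6];   [:: 'F 5; 'F 7; 'R 5; 'R 7];
      [:: 'R 8; 'R 9; 'F 8; 'F 9];   [:: 'R 10; 'R 11; 'F 10; 'F 11]].

(* Found by computer search. *)
Definition table6x6 : seq (seq code) :=
  [:: [:: 'R 11; 'R 8; 'R 15; 'F 14; 'F 4; 'R 2];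
      [:: 'F 11; 'R 1; 'R 0; 'R 7; 'R 10; 'F 9];
      [:: 'F 7; 'F 16; 'F 12; 'F 5; 'F 13; 'F 3];
      [:: 'R 9; 'F 1; 'F 15; 'F 0; 'R 6; 'F 17];
      [:: 'R 5; 'F 8; 'R 4; 'R 16; 'R 17; 'F 6];
      [:: 'R 3; 'F 2; 'R 14; 'F 10; 'R 12; 'R 13]].

Lemma balanced_table4x4 : balanced_table table4x4 4 4 8.
Proof. by vm_compute. Qed.

Lemma balanced_table6x4 : balanced_table table6x4 6 4 12.
Proof. by vm_compute. Qed.

Lemma balanced_table6x6 : balanced_table table6x6 6 6 18.
Proof. by vm_compute. Qed.

(** * Arrays with trivial lines and their juxtaposition *)

Section Tiling.

Variables (gT : finGroupType) (x y : gT).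
Hypotheses (y2 : (y ^+ 2 = 1)%g) (xy : (x ^ y = x^-1)%g).

Definition decode (c : nat) (u : code) : gT := (x ^+ (c + u.2) * y ^+ u.1)%g.

Definition trivial_line (l : seq gT) : Prop :=
  exists2 w, perm_eq w l & (\prod_(u <- w) u = 1)%g.

Definition tileable (p q : nat) : Prop :=
  exists2 m, p * q = m.*2 &
  forall c, exists A : nat -> nat -> gT,
  [/\ forall i, i < p -> trivial_line (mkseq (A i) q),
      forall j, j < q -> trivial_line (mkseq (A ^~ j) p)
    & forall (b : bool) k, c <= k < c + m ->
        exists i j, [/\ i < p, j < q & A i j = (x ^+ k * y ^+ b)%g]].

Lemma trivial_line_cat l1 l2 :
  trivial_line l1 -> trivial_line l2 -> trivial_line (l1 ++ l2).
Proof.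
move=> [w1 p1 e1] [w2 p2 e2]; exists (w1 ++ w2); first exact: perm_cat.
by rewrite big_cat e1 e2 /= mulg1.
Qed.

Lemma mkseq_cat (T : Type) (f : nat -> T) a b :
  mkseq f (a + b) = mkseq f a ++ mkseq (fun j => f (a + j)) b.
Proof.
by rewrite /mkseq iotaD add0n map_cat -[X in iota X b]addn0 iotaDl -map_comp.
Qed.

Lemma eq_in_mkseq (T : Type) (f g : nat -> T) n :
  (forall i, i < n -> f i = g i) -> mkseq f n = mkseq g n.
Proof.
by move=> fg; apply/eq_in_map=> i; rewrite mem_iota => /andP[_]; apply: fg.
Qed.

Lemma tileable_transpose p q : tileable p q -> tileable q p.
Proof.
move=> [m pq At]; exists m; first by rewrite mulnC.
move=> c; have [A [rA cA eA]] := At c; exists (fun i j => A j i); split=> //.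
by move=> b k /(eA b)[i [j [ip jq e]]]; exists j, i.
Qed.

Lemma tileable_cat p q1 q2 :
  tileable p q1 -> tileable p q2 -> tileable p (q1 + q2).
Proof.
move=> [m1 pq1 A1] [m2 pq2 A2]; exists (m1 + m2).
  by rewrite mulnDr pq1 pq2 doubleD.
move=> c; have [A [rA cA eA]] := A1 c.
(* The right block takes the window that starts where that of the left block ends. *)
have [B [rB cB eB]] := A2 (c + m1).
exists (fun i j => if j < q1 then A i j else B i (j - q1)); split.
- move=> i ip; rewrite mkseq_cat.
  rewrite (_ : mkseq _ q1 = mkseq (A i) q1); last first.
    by apply: eq_in_mkseq => j ->.
  rewrite (_ : mkseq _ q2 = mkseq (B i) q2).
    by apply: trivial_line_cat; [apply: rA | apply: rB].
  by apply: eq_in_mkseq => j _ /=; rewrite ltnNge leq_addr addKn.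
- move=> j jq; case: ltnP => jq1; first exact: cA.
  by apply: cB; rewrite ltn_subLR.
- move=> b k /andP[ck kc]; case: (ltnP k (c + m1)) => km.
    have [|i [j [ip jq e]]] := eA b k; first by rewrite ck.
    by exists i, j; rewrite jq (ltn_addr _ jq).
  have [|i [j [ip jq e]]] := eB b k; first by rewrite km -addnA.
  by exists i, (q1 + j); rewrite ltn_add2l [_ < q1]ltnNge leq_addr addKn.
Qed.

Lemma reflection_comm k : (y * x ^+ k = x ^- k * y)%g.
Proof.
have yV : (y^-1 = y)%g by apply: (mulgI y); rewrite mulgV -y2.
by rewrite -expgVn -xy -conjXg conjgE {1}yV -!mulgA [(y * y)%g]y2 mulg1.
Qed.

(** Induction on the word: carrying a leading [y] to the right through the tail inverts the powers
    of [x] there, hence the exchange of the two lists in [signed_exponents]. The shift [c] enters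
    once per letter, with the sign of that letter. *)
Lemma prod_decode c (w : seq code) :
  let: (P, M, e) := signed_exponents w in
  (\prod_(u <- w) decode c u =
     x ^+ (c * size P + sumn P) * x ^- (c * size M + sumn M) * y ^+ e)%g.
Proof.
elim: w => [|[b k] w] /=; first by rewrite big_nil !muln0 mulgV mulg1.
case: (signed_exponents w) => [[P M] e]; rewrite big_cons => ->.
have yxV j : (y * x ^- j = x ^+ j * y)%g.
  by apply: (mulgI (x ^- j)%g); rewrite mulKg mulgA -reflection_comm mulgK.
have ye : (y * y ^+ e = y ^+ (~~ e))%g by case: e; rewrite ?mulg1 //= -expg2 y2.
case: b; rewrite /decode /= mulnS addnACA [in RHS]expgD -!mulgA.
  congr (_ * _)%g; rewrite expg1 (mulgA y) reflection_comm -(mulgA _ y).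
  rewrite (mulgA y) yxV -(mulgA _ y) ye !mulgA; congr (_ * _)%g.
  (* The inverted powers of [x] appear in the opposite order, but they commute. *)
  exact: commuteX (commute_sym (commuteV (commuteX _ (commute_refl x)))).
by rewrite mul1g.
Qed.

Lemma balanced_prod c w : balanced w -> (\prod_(u <- w) decode c u = 1)%g.
Proof.
rewrite /balanced; have := prod_decode c w.
case: (signed_exponents w) => [[P M] e] -> /and3P[/eqP-> /eqP-> /negPf->].
by rewrite mulgV mulg1.
Qed.

Lemma balanceable_line c l : balanceable l -> trivial_line (map (decode c) l).
Proof.
case/hasP=> w; rewrite mem_permutations => wl bw.
by exists (map (decode c) w); [apply: perm_map | rewrite big_map balanced_prod].
Qed.

Lemma tileable_table t p q m :
  p * q = m.*2 -> balanced_table t p q m -> tileable p q.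
Proof.
move=> pq /and3P[/allP rt /allP ct /allP et]; exists m => // c.
exists (fun i j => decode c (table_entry t i j)); split.
- move=> i ip; rewrite /mkseq (map_comp (decode c)); apply: balanceable_line.
  by apply: rt; rewrite mem_iota.
- move=> j jq; rewrite /mkseq (map_comp (decode c) (table_entry t ^~ j)).
  by apply: balanceable_line; apply: ct; rewrite mem_iota.
- move=> b k /andP[ck kc].
  have km : k - c \in iota 0 m by rewrite mem_iota ltn_subLR.
  have bft : b \in [:: false; true] by case: b.
  have /allpairsP[[i j]] := allP (et _ km) _ bft.
  rewrite !mem_iota /= => -[ip jq e].
  by exists i, j; rewrite ip jq -e /decode /= subnKC.
Qed.

(** * Square arrays of every even side from 4 on *)

Lemma tileable44 : tileable 4 4.
Proof. exact: tileable_table balanced_table4x4. Qed.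

Lemma tileable64 : tileable 6 4.
Proof. exact: tileable_table balanced_table6x4. Qed.

Lemma tileable66 : tileable 6 6.
Proof. exact: tileable_table balanced_table6x6. Qed.

Lemma even_ge4_ind (P : nat -> Prop) :
  P 4 -> P 6 -> (forall n, ~~ odd n -> 4 <= n -> P n -> P (n + 4)) ->
  forall n, ~~ odd n -> 4 <= n -> P n.
Proof.
move=> P4 P6 IH n; have [k] := ubnP n.
elim: k n => // k IHk n nk en n4.
have [n8|n8] := leqP 8 n.
  have n4' : 4 <= n by apply: leq_trans n8.
  rewrite -(subnK n4'); apply: IH.
  - by rewrite oddB // addbF.
  - by rewrite leq_subRL.
  apply: IHk; rewrite ?oddB ?addbF ?leq_subRL //.
  by rewrite ltn_subLR // (leq_trans nk) // addSn ltnS leq_addl.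
by case: n {nk} en n4 n8 => [|[|[|[|[|[|[|[|]]]]]]]].
Qed.

Lemma tileable_strip n : ~~ odd n -> 4 <= n -> tileable 4 n.
Proof.
move: n; apply: even_ge4_ind; first exact: tileable44.
  exact: tileable_transpose tileable64.
by move=> n _ _ tn; apply: tileable_cat tn tileable44.
Qed.

(** Induction step: an n x n array is bordered by an n x 4 strip on one side and a 4 x (n + 4) strip
    on the other. *)
Lemma tileable_square n : ~~ odd n -> 4 <= n -> tileable n n.
Proof.
move: n; apply: even_ge4_ind; first exact: tileable44.
  exact: tileable66.
move=> n en n4 tn; have t4 := tileable_strip en n4.
have t := tileable_cat (tileable_transpose tn) (tileable_transpose t4).
apply: tileable_cat (tileable_transpose t) _.
exact: tileable_transpose (tileable_cat t4 tileable44).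
Qed.

(** * From arrays to semi-magic squares over the dihedral group *)

Lemma trivial_line_perm n (f : 'I_n -> gT) (g : nat -> gT) :
  (forall i : 'I_n, f i = g i) -> trivial_line (mkseq g n) ->
  exists s : 'S_n, (\prod_(k < n) f (s k) = 1)%g.
Proof.
move=> fg [w pw e]; move: pw.
rewrite (_ : mkseq g n = [tuple f i | i < n]).
  case/tuple_permP=> s ws; exists s; rewrite -[RHS]e ws big_tuple.
  by apply: eq_bigr => i _; rewrite !tnth_mktuple.
rewrite /mkseq -val_enum_ord -map_comp.
by apply: eq_map => i /=; rewrite fg.
Qed.

Lemma square_of_tileable n :
  #|[set: gT]| = n ^ 2 ->
  (forall z : gT, exists b : bool, exists2 k,
     k < (n ^ 2)./2 & z = (x ^+ k * y ^+ b)%g) ->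
  tileable n n -> exists a : 'M[gT]_n, semi_magic_square a.
Proof.
move=> cG surj [m nm /(_ 0)[A [rA cA eA]]].
pose a : 'M[gT]_n := (\matrix_(i, j) A i j)%R.
exists a; split; last first.
  exists 1%g; split=> [i|j].
    by apply: (@trivial_line_perm _ (a i)) (rA i _) => // j; rewrite mxE.
  by apply: (@trivial_line_perm _ (a ^~ j)) (cA j _) => // i; rewrite mxE.
pose f (p : 'I_n * 'I_n) := a p.1 p.2.
have cE : #|{: 'I_n * 'I_n}| = #|gT| by rewrite card_prod card_ord -cardsT cG.
apply: (@inj_card_bij _ _ f); last by rewrite cE.
(* The index pairs and [gT] are equally many, so injectivity follows once the entries exhaust [gT];
   the window from 0 of length [m], half of [n ^ 2], achieves this. *)
suff /eqP/image_injP fi : #|image f predT| = #|{: 'I_n * 'I_n}|.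
  by move=> u v; apply: fi; rewrite inE.
rewrite cE; apply/eq_card => z; rewrite [RHS]inE; apply/idP.
have [b [k kn ->]] := surj z.
have [|i [j [ip jq <-]]] := eA b k.
  by rewrite add0n /=; move: kn; rewrite -mulnn nm doubleK.
by apply/imageP; exists (Ordinal ip, Ordinal jq); rewrite // /f mxE.
Qed.

End Tiling.

Lemma dihedral_elements k : 1 < k ->
  exists x y : 'D_(k.*2), [/\ (y ^+ 2 = 1)%g, (x ^ y = x^-1)%g
   & forall z, exists b : bool, exists2 i, i < k & z = (x ^+ i * y ^+ b)%g].
Proof.
move=> k1; have /existsP[[x y] /=] : [set: 'D_(k.*2)]%G \homg
    Grp (x : y : x ^+ k, y ^+ 2, x ^ y = x^-1)%g.
  by rewrite -Grp_dihedral // homg_refl.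
rewrite !xpair_eqE => /and4P[/eqP gxy /eqP xk /eqP y2 /eqP xy].
exists x, y; split=> // z.
(* As [y] normalises [<[x]>], the two cycles generate their product set, so every element has the
   form [x ^+ i * y ^+ j]. *)
have nyx : (<[y]> \subset 'N(<[x]>))%g.
  by rewrite norms_cycle xy groupV cycle_id.
have : z \in (<[x]> * <[y]>)%g by rewrite -norm_joinEr // gxy inE.
case/mulsgP=> _ _ /cycleP[i ->] /cycleP[j ->] ->.
exists (odd j), (i %% k); first by rewrite ltn_pmod // ltnW.
rewrite (expg_mod _ xk); congr (_ * _)%g.
by rewrite -(expg_mod j y2) modn2.
Qed.

Theorem theorem6p1 (n : nat) (hn : 0 < n) :
  (exists gT : finGroupType,
     [/\ dihedral [set: gT]%G, #|[set: gT]| = n ^ 2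
       & exists a : 'M[gT]_n, semi_magic_square a])
  <-> (~~ odd n /\ 4 <= n).
Proof.
split.
  move=> [gT [[k k3 /card_isog]]].
  rewrite card_dihedral ?(ltnW k3) //= => -> kn _.
  have en : ~~ odd n by rewrite -[odd n](oddX n 2) -kn odd_double.
  (* The bound [3 <= k] excludes side 2, where the group would have order 4. *)
  split=> //; have : 6 <= n ^ 2 by rewrite -kn -[6]/(3.*2) leq_double.
  by case: n en {hn kn} => [|[|[|[|]]]].
move=> [en n4]; set k := (n ^ 2)./2.
have kn : k.*2 = n ^ 2 by rewrite /k halfK oddX (negPf en) subn0.
have k3 : 3 <= k by rewrite -leq_double kn (leq_trans _ (leq_mul n4 n4)).
have k1 := ltnW k3.
have [x [y [y2 xy surj]]] := dihedral_elements k1.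
exists 'D_(k.*2); split.
- by exists k; rewrite ?isog_refl.
- by rewrite card_dihedral.
- apply: square_of_tileable (tileable_square y2 xy en n4) => //.
  by rewrite card_dihedral.
Qed.
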